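(* Let $(X,d)$ be a complete metric space, let $f,g:X\to X$ be self-mappings, and let $f$ be a Suzuki type generalized $(Z_G,g)$-contraction. Assume that (i) $f(X)\subseteq g(X)$, (ii) $g$ is continuous, and (iii) $f$ and $g$ are commuting, i.e. $fgx=gfx$ for all $x\in X$. Then $f$ and $g$ have a unique point of coincidence, i.e. there is exactly one $u\in X$ for which there exists $v\in X$ with $u=fv=gv$.
   Context: Metric spaces are assumed nonempty. A $C$-class function is a continuous map $G:[0,\infty)^2\to\mathbb{R}$ such that for all $s,t\in[0,\infty)$: $G(s,t)\le s$; and $G(s,t)=s$ implies $s=0$ or $t=0$. A map $G:[0,\infty)^2\to\mathbb{R}$ has property $C_G$ if there is a constant $C_G\ge 0$ such that (i) $G(s,t)>C_G$ implies $s>t$; (ii) $G(t,t)\le C_G$ for all $t\in[0,\infty)$. Fix a $C$-class function $G$ with property $C_G$, and fix the corresponding constant $C_G\ge 0$. A $C_G$-simulation function is a map $\zeta:[0,\infty)^2\to\mathbb{R}$ such that: (a) $\zeta(t,s)<G(s,t)$ for all $t,s>0$; (b) if $\{t_n\},\{s_n\}$ are sequences in $(0,\infty)$ with $\lim_{n\to\infty}t_n=\lim_{n\to\infty}s_n>0$ and $t_n<s_n$ for all $n$, then $\limsup_{n\to\infty}\zeta(t_n,s_n)<C_G$. $Z_G$ denotes the family of all $C_G$-simulation functions. For self-mappings $f,g$ of a metric space $(X,d)$, put $$M(x,y)=\max\left\{d(gx,gy),\,d(gx,fx),\,d(gy,fy),\,\frac{d(gx,fy)+d(gy,fx)}{2}\right\}.$$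 The mapping $f$ is a Suzuki type generalized $(Z_G,g)$-contraction if there exists $\zeta\in Z_G$ such that for all $x,y\in X$ with $gx\ne gy$: $$\tfrac12 d(gx,fx)<d(gx,gy)\ \Longrightarrow\ \zeta\big(d(fx,fy),M(x,y)\big)\ge C_G.$$ A point $u\in X$ is a point of coincidence of $f$ and $g$ if $u=fv=gv$ for some $v\in X$. *)

(* Defs.v *)
From HB Require Import structures.
From mathcomp Require Import all_boot all_order all_algebra.
From mathcomp Require Import all_classical all_reals all_analysis.

Set Implicit Arguments.
Unset Strict Implicit.
Unset Printing Implicit Defensive.

Import Order.TTheory GRing.Theory Num.Theory.
Import numFieldNormedType.Exports.

Local Open Scope classical_set_scope.
Local Open Scope ring_scope.

(* [completeType] is pointed, hence such a space is nonempty. *)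
#[short(type="completeMetricType")]
HB.structure Definition CompleteMetric (R : numDomainType) :=
  {T of Complete T & Metric R T}.

(* Maps [0, +oo[^2 -> R are represented by total functions R -> R -> R whose
   values outside the closed quadrant are irrelevant: every condition below is
   restricted to nonnegative arguments. *)

Definition quadrant (R : realType) : set (R * R) :=
  [set p | 0 <= p.1 /\ 0 <= p.2].
Arguments quadrant : clear implicits.

Definition C_class (R : realType) (G : R -> R -> R) : Prop :=
  [/\ {within quadrant R, continuous (fun p : R * R => G p.1 p.2)},
      forall s t, 0 <= s -> 0 <= t -> G s t <= s &
      forall s t, 0 <= s -> 0 <= t -> G s t = s -> s = 0 \/ t = 0].

Definition property_C (R : realType) (G : R -> R -> R) (CG : R) : Prop :=
  [/\ 0 <= CG,
      forall s t, 0 <= s -> 0 <= t -> CG < G s t -> t < s &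
      forall t, 0 <= t -> G t t <= CG].

(* The limit superior is taken in the extended reals. *)
Definition simulation_function (R : realType) (G : R -> R -> R) (CG : R)
    (zeta : R -> R -> R) : Prop :=
  (forall t s, 0 < t -> 0 < s -> zeta t s < G s t) /\
  (forall (t s : nat -> R) (l : R),
     (forall n, 0 < t n) -> (forall n, 0 < s n) ->
     t @ \oo --> l -> s @ \oo --> l -> 0 < l ->
     (forall n, t n < s n) ->
     (limn_esup (fun n => (zeta (t n) (s n))%:E) < CG%:E)%E).

Section self_mappings.
Context {R : realType} {X : metricType R}.
Implicit Types f g : X -> X.

Definition Mfg f g (x y : X) : R :=
  Num.max (mdist (g x) (g y))
    (Num.max (mdist (g x) (f x))
      (Num.max (mdist (g y) (f y))
        ((mdist (g x) (f y) + mdist (g y) (f x)) / 2))).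

Definition suzuki_contraction (G : R -> R -> R) (CG : R) f g : Prop :=
  exists zeta : R -> R -> R, simulation_function G CG zeta /\
    forall x y : X, g x <> g y ->
      2^-1 * mdist (g x) (f x) < mdist (g x) (g y) ->
      CG <= zeta (mdist (f x) (f y)) (Mfg f g x y).

Definition point_of_coincidence f g (u : X) : Prop :=
  exists v : X, u = f v /\ u = g v.

End self_mappings.

(* Main.v *)
Require Import Defs.
From HB Require Import structures.
From mathcomp Require Import all_boot all_order all_algebra.
From mathcomp Require Import all_classical all_reals all_analysis.
From mathcomp Require Import lra.

Import Order.TTheory GRing.Theory Num.Theory.
Import numFieldNormedType.Exports.

Local Open Scope classical_set_scope.
Local Open Scope ring_scope.

(** The function [zeta] enters only through two consequences of the contraction
    condition.  For a pair x, y satisfying Suzuki's premise, strict contraction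
    d(fx, fy) < M(x, y) holds as soon as fx and fy differ ([contraction_lt]),
    because C_G <= zeta(t, s) < G(s, t) forces t < s.  And along such pairs
    d(fx_n, fy_n) and M(x_n, y_n) cannot have a common positive limit
    ([contraction_limit]), because the limit superior of [zeta] would then be
    both at least and less than C_G.

    Since f(X) lies in g(X), there is a Jungck sequence, g a_(n+1) = f a_n.
    Assume that f and g have no coincidence.  Then the steps
    d(g a_n, g a_(n+1)) strictly decrease by the first principle and tend to 0
    by the second ([step_cvg0]); were g a not Cauchy, one could pick pairs of
    indices whose distances converge to some e > 0, and M would follow them to
    the same limit, contradicting the second principle ([jungck_tail]).  So g a
    converges to some z.

    Commutation makes b = g o a a Jungck sequence too, and continuity gives
    g b_n --> g z, a limit inside g(X).  Among any two consecutive terms of b at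
    least one forms a Suzuki pair with z ([suzuki_dichotomy]), as otherwise the
    triangle inequality would make a step at most half of the sum of itself and
    the next, smaller, one.  Along these terms d(f b_n, f z) and M(b_n, z) both
    tend to d(fz, gz), which must therefore vanish
    ([jungck_limit_coincidence]).

    Uniqueness: if fv = gv and fw = gw differ, then (v, w) is a Suzuki pair with
    M(v, w) = d(fv, fw), against strict contraction. *)

(** * The two contraction principles *)

Lemma limn_esup_ge (R : realType) (u : nat -> \bar R) (c : \bar R) :
  (forall n, (c <= u n)%E) -> (c <= limn_esup u)%E.
Proof.
move=> cu; apply: le_ereal_inf_tmp => _ [V [N _ NV] <-].
by apply: (le_trans (cu N)); apply: ereal_sup_ubound; exists N => //;
  apply: NV => /=.
Qed.

Section contraction.
Context {R : realType} {X : metricType R}.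
Implicit Types (f g : X -> X) (x y : X) (a : nat -> X).

Local Notation d := (@mdist R X).

Definition suzuki_pair f g x y := 2^-1 * d (g x) (f x) < d (g x) (g y).

Lemma suzuki_pair_gt0 f g x y : suzuki_pair f g x y -> 0 < d (g x) (g y).
Proof. by apply: le_lt_trans; rewrite mulr_ge0// ?invr_ge0// mdist_ge0. Qed.

Lemma suzuki_pair_neq f g x y : suzuki_pair f g x y -> g x <> g y.
Proof. by move=> /suzuki_pair_gt0; rewrite mdist_gt0 => /eqP. Qed.

Lemma Mfg_ge_dist f g x y : d (g x) (g y) <= Mfg f g x y.
Proof. by rewrite /Mfg le_max lexx. Qed.

Lemma Mfg_ge_dist_right f g x y : d (g y) (f y) <= Mfg f g x y.
Proof. by rewrite /Mfg !le_max lexx !orbT. Qed.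

Lemma Mfg_le f g x y B :
  d (g x) (g y) <= B -> d (g x) (f x) <= B -> d (g y) (f y) <= B ->
  d (g x) (f y) + d (g y) (f x) <= B + B -> Mfg f g x y <= B.
Proof.
by move=> h1 h2 h3 h4; rewrite /Mfg !ge_max h1 h2 h3 /= ler_pdivrMr//; lra.
Qed.

Lemma cvg_mdist (u : nat -> X) (z : X) :
  u @ \oo --> z -> (fun n => d (u n) z) @ \oo --> 0.
Proof.
move=> /metricType_numDomainType.cvgrPdist_lt uz.
apply/cvgrPdist_lt => e e0; apply: filterS (uz e e0) => n.
by rewrite sub0r normrN ger0_norm ?mdist_ge0// metric_sym.
Qed.

Section contraction_principles.
Context {G : R -> R -> R} {CG : R} {f g : X -> X}.
Context (hCG : property_C G CG) (hf : suzuki_contraction G CG f g).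

(** Here C_G <= zeta(t, s) < G(s, t) with t = d(fx, fy) and s = M(x, y) both
    positive, and property C_G turns C_G < G(s, t) into t < s. *)
Lemma contraction_lt x y :
  suzuki_pair f g x y -> f x <> f y -> d (f x) (f y) < Mfg f g x y.
Proof.
move=> hxy fxy; case: hf => zeta [[zetaG _] hz].
have t0 : 0 < d (f x) (f y) by rewrite mdist_gt0; exact/eqP.
have M0 : 0 < Mfg f g x y.
  exact: lt_le_trans (suzuki_pair_gt0 _ _ _ _ hxy) (Mfg_ge_dist _ _ _ _).
case: hCG => _ hlt _; apply: hlt; [exact: ltW|exact: ltW|].
by apply: le_lt_trans (zetaG _ _ t0 M0); exact: hz (suzuki_pair_neq _ _ _ _ hxy) _.
Qed.

(** The limit superior condition on [zeta] is stated for sequences with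
    0 < t_n < s_n for every n.  The limit being positive, d(fx_n, fy_n) is
    positive on a tail, where [contraction_lt] supplies t_n < s_n; dropping the
    first N terms then gives admissible sequences along which [zeta] stays at
    least C_G. *)
Lemma contraction_limit (x y : nat -> X) (l : R) : 0 < l ->
  (\forall n \near \oo, suzuki_pair f g (x n) (y n)) ->
  (fun n => d (f (x n)) (f (y n))) @ \oo --> l ->
  (fun n => Mfg f g (x n) (y n)) @ \oo --> l -> False.
Proof.
move=> l0 xy tl Ml.
have [N _ Nt] : \forall n \near \oo,
    suzuki_pair f g (x n) (y n) /\ 0 < d (f (x n)) (f (y n)).
  by near=> n; split; near: n; [exact: xy|exact: (cvgr_gt l tl)].
have tail n : suzuki_pair f g (x (n + N)%N) (y (n + N)%N) /\
    0 < d (f (x (n + N)%N)) (f (y (n + N)%N)).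
  by apply: Nt; exact: leq_addl.
have lt n : d (f (x (n + N)%N)) (f (y (n + N)%N))
    < Mfg f g (x (n + N)%N) (y (n + N)%N).
  have [xyn t0] := tail n.
  by apply: contraction_lt => //; apply/eqP; rewrite -mdist_gt0.
case: hf => zeta [[_ zetalim] hz].
have := zetalim (fun n => d (f (x (n + N)%N)) (f (y (n + N)%N)))
  (fun n => Mfg f g (x (n + N)%N) (y (n + N)%N)) l.
move=> /(_ _ _ _ _ l0 lt) H.
suff: (CG%:E < CG%:E)%E by rewrite ltxx.
apply: (le_lt_trans _ (H _ _ _ _)).
- by apply: limn_esup_ge => n; rewrite lee_fin; apply: hz;
    [exact: suzuki_pair_neq (tail n).1|exact: (tail n).1].
- by move=> n; exact: (tail n).2.
- by move=> n; apply: le_lt_trans (lt n); exact: mdist_ge0.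
- by rewrite -(cvg_shiftn N) in tl.
- by rewrite -(cvg_shiftn N) in Ml.
Unshelve. all: by end_near. Qed.

(** * Jungck sequences without coincidence *)

Section jungck.
Context {a : nat -> X} (ga : forall n, g (a n.+1) = f (a n))
  (fga : forall n, f (a n) <> g (a n)).

Local Notation step n := (d (g (a n)) (g (a n.+1))).

Lemma step_gt0 n : 0 < step n.
Proof. by rewrite mdist_gt0 ga eq_sym; exact/eqP. Qed.

Lemma step_suzuki n : suzuki_pair f g (a n) (a n.+1).
Proof. by rewrite /suzuki_pair -ga; have := step_gt0 n; lra. Qed.

Lemma Mfg_step_le n : Mfg f g (a n) (a n.+1) <= Num.max (step n) (step n.+1).
Proof.
have h1 : step n <= Num.max (step n) (step n.+1) by rewrite le_max lexx.
have h2 : step n.+1 <= Num.max (step n) (step n.+1) by rewrite le_max lexx orbT.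
apply: Mfg_le; rewrite -?ga// mdistxx addr0.
by apply: le_trans (metric_triangle _ (g (a n.+1)) _) _; exact: lerD.
Qed.

(** M(a_n, a_(n+1)) is at most the larger of the steps n and n+1, and being below
    the step n+1 itself is absurd. *)
Lemma step_lt n : step n.+1 < step n.
Proof.
have := @contraction_lt _ _ (step_suzuki n).
rewrite -!ga => /(_ _)/lt_le_trans.
move=> /(_ _ _ (Mfg_step_le n)); rewrite lt_max ltxx orbF; apply.
by rewrite !ga -ga; exact/nesym/fga.
Qed.

Lemma step_le n m : (n <= m)%N -> step m <= step n.
Proof.
elim: m => [|m IH]; first by rewrite leqn0 => /eqP ->.
rewrite leq_eqVlt => /predU1P[->//|nm].
exact: le_trans (ltW (step_lt m)) (IH nm).
Qed.

Lemma Mfg_step n : Mfg f g (a n) (a n.+1) = step n.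
Proof.
apply/le_anti; rewrite Mfg_ge_dist andbT (le_trans (Mfg_step_le n))//.
by rewrite ge_max lexx ltW// step_lt.
Qed.

(** If the limit r of the decreasing steps were positive, the pairs
    (a_n, a_(n+1)) would have d(f a_n, f a_(n+1)) and M equal to consecutive
    steps, both tending to r. *)
Lemma step_cvg0 : (fun n => step n) @ \oo --> 0.
Proof.
set r := inf (range (fun n => step n)).
have lb0 : has_lbound (range (fun n => step n)).
  by exists 0 => _ [n _ <-]; exact: mdist_ge0.
have cvr : (fun n => step n) @ \oo --> r.
  by apply: nonincreasing_cvgn => // n m; exact: step_le.
have r0 : 0 <= r.
  by apply: lb_le_inf; [exists (step 0%N), 0%N|move=> _ [n _ <-]; exact: mdist_ge0].
suff <- : r = 0 by [].
apply/eqP; rewrite eq_le r0 andbT leNgt; apply/negP => rpos.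
apply: (@contraction_limit a (fun n => a n.+1) r) => //.
- by apply: nearW; exact: step_suzuki.
- rewrite -(cvg_shiftn 1) in cvr.
  by under eq_fun do rewrite -!ga -addn1.
- by under eq_fun do rewrite Mfg_step.
Qed.

(** Taking the first index at which the sequence leaves the ball of radius e
    around g a_N overshoots e by no more than the last step, which is at most
    step N. *)
Lemma far_pair (e : R) (N : nat) :
  ~ (forall n, (N <= n)%N -> d (g (a N)) (g (a n)) < e) -> 0 < e ->
  exists n, [/\ (N <= n)%N, e <= d (g (a N)) (g (a n.+1)) &
    d (g (a N)) (g (a n.+1)) <= e + step N].
Proof.
move=> far e0.
have ex : exists k, e <= d (g (a N)) (g (a (N + k)%N)).
  move: far => /existsNP[n /not_implyP[Nn /negP]]; rewrite -leNgt => en.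
  by exists (n - N)%N; rewrite subnKC.
case: (ex_minnP ex) => -[|k]; first by rewrite addn0 mdistxx leNgt e0.
rewrite addnS => ek kmin; exists (N + k)%N; split=> //; first exact: leq_addr.
have ltk : d (g (a N)) (g (a (N + k)%N)) < e.
  by rewrite ltNge; apply/negP => /kmin; rewrite ltnn.
apply: le_trans (metric_triangle _ (g (a (N + k)%N)) _) _.
by apply: lerD; [exact: ltW|apply: step_le; exact: leq_addr].
Qed.

(** If the sequence leaves every tail ball, [far_pair] at N+1 gives indices k N
    with d(f a_N, f a_(k N)) between e and e + step N; shifting both indices
    down by one changes distances by at most 2 step N, so M(a_N, a_(k N)) tends
    to e as well and [contraction_limit] applies. *)
Lemma jungck_tail (e : R) : 0 < e ->
  exists N, forall n, (N <= n)%N -> d (g (a N)) (g (a n)) < e.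
Proof.
move=> e0; apply: contrapT => far.
have {}far N : exists n, [/\ (N < n)%N, e <= d (g (a N.+1)) (g (a n.+1)) &
    d (g (a N.+1)) (g (a n.+1)) <= e + step N.+1].
  apply: far_pair => // h; apply: far; exists N.+1; exact: h.
have [k hk] := choice far.
have Nk N : (N <= k N)%N by have [/ltnW] := hk N.
have lin c : (fun n => e + c * step n) @ \oo --> e.
  rewrite -[X in _ --> X]addr0 -[X in _ + X](mulr0 c).
  by apply: cvgD; [exact: cvg_cst|apply: cvgMr; exact: step_cvg0].
have lo N : e - 2 * step N <= d (g (a N)) (g (a (k N))).
  have [_ + _] := hk N; have := step_le _ _ (Nk N).
  have := metric_triangle (g (a N.+1)) (g (a N)) (g (a (k N).+1)).
  have := metric_triangle (g (a N)) (g (a (k N))) (g (a (k N).+1)).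
  by rewrite (metric_sym (g (a N.+1)) (g (a N))); lra.
have sN N : step N.+1 <= step N by exact/ltW/step_lt.
apply: (@contraction_limit a (a \o k) e) => //.
  (* step N < e / 4 makes step N / 2 < e - 2 step N, the lower bound [lo]. *)
- have : \forall n \near \oo, 0 < e / 4 - step n.
    apply: (cvgr_gt (e / 4)); last lra.
    rewrite -[X in _ --> X]subr0.
    by apply: cvgB; [exact: cvg_cst|exact: step_cvg0].
  apply: filterS => N small; rewrite /suzuki_pair -ga /=.
  by have := lo N; have := step_gt0 N; lra.
- apply: (@squeeze_cvgr _ _ _ _ (cst e) (fun n => e + 1 * step n)) => //.
    apply: nearW => N; have [_ h1 h2] := hk N; rewrite /= -!ga.
    by have := sN N; lra.
  exact: cvg_cst.
- apply: (@squeeze_cvgr _ _ _ _ (fun n => e + - 2 * step n)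
    (fun n => e + 3 * step n)) => //.
  apply: nearW => N; apply/andP; split => /=.
    by apply: le_trans (Mfg_ge_dist _ _ _ _); have := lo N; lra.
  have [_ h1 h2] := hk N; have := sN N; have := step_le _ _ (Nk N).
  have := step_gt0 N; have := step_gt0 (k N).
  have := metric_triangle (g (a N)) (g (a N.+1)) (g (a (k N).+1)).
  have := metric_triangle (g (a N)) (g (a (k N).+1)) (g (a (k N))).
  have := metric_triangle (g (a (k N))) (g (a (k N).+1)) (g (a N.+1)).
  rewrite (metric_sym (g (a (k N).+1)) (g (a (k N)))).
  rewrite (metric_sym (g (a (k N).+1)) (g (a N.+1))).
  by move=> *; apply: Mfg_le; rewrite -?ga; lra.
Qed.

(** If both failed, step n <= d(g a_n, g z) + d(g a_(n+1), g z)
    <= (step n + step (n+1)) / 2 < step n. *)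
Lemma suzuki_dichotomy (z : X) n :
  suzuki_pair f g (a n) z \/ suzuki_pair f g (a n.+1) z.
Proof.
rewrite /suzuki_pair -!ga.
have := metric_triangle (g (a n)) (g z) (g (a n.+1)).
rewrite (metric_sym (g z)); have := step_lt n.
case: (ltP (2^-1 * step n) (d (g (a n)) (g z))) => [|h1]; first by left.
by right; lra.
Qed.

(** The limit must be of the form g z: both d(f a_n, f z) and M(a_n, z) then tend
    to d(fz, gz), along the indices n provided by [suzuki_dichotomy]. *)
Lemma jungck_limit_coincidence (z : X) :
  (fun n => g (a n)) @ \oo --> g z -> f z = g z.
Proof.
move=> gaz; apply/eqP/negPn; rewrite -mdist_gt0; apply/negP => l0.
have [k hk] : {k : nat -> nat &
    forall n, (n <= k n)%N /\ suzuki_pair f g (a (k n)) z}.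
  apply: (choice (P := fun n k => (n <= k)%N /\ suzuki_pair f g (a k) z)) => n.
  by case: (suzuki_dichotomy z n) => h; [exists n|exists n.+1].
have e0 := cvg_mdist _ _ gaz.
have sub (j : nat) : (fun n => (k n + j)%N) @ \oo --> \oo.
  move=> A [N _ NA]; exists N => // n /= Nn; apply: NA => /=.
  by rewrite (leq_trans Nn)// (leq_trans (hk n).1)// leq_addr.
have e0k : (fun n => d (g (a (k n))) (g z)) @ \oo --> 0.
  have := cvg_comp _ _ (sub 0%N) e0.
  by rewrite (_ : _ \o _ = fun n => d (g (a (k n))) (g z))//;
    apply/funext => n /=; rewrite addn0.
have e1k : (fun n => d (g (a (k n).+1)) (g z)) @ \oo --> 0.
  have := cvg_comp _ _ (sub 1%N) e0.
  by rewrite (_ : _ \o _ = fun n => d (g (a (k n).+1)) (g z))//;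
    apply/funext => n /=; rewrite addn1.
set l := d (f z) (g z) in l0 *.
(* This single error term bounds the deviation of both sequences from l. *)
set e := fun n => d (g (a (k n))) (g z) + d (g (a (k n).+1)) (g z).
have e_cvg0 : e @ \oo --> 0.
  by rewrite -[X in _ --> X]addr0; exact: cvgD.
have le_cvg : (fun n => l + e n) @ \oo --> l.
  by rewrite -[X in _ --> X]addr0; apply: cvgD => //; exact: cvg_cst.
have le_cvgN : (fun n => l - e n) @ \oo --> l.
  by rewrite -[X in _ --> X]subr0; apply: cvgB => //; exact: cvg_cst.
have p0 n : 0 <= d (g (a (k n))) (g z) := mdist_ge0 _ _.
have p1 n : 0 <= d (g (a (k n).+1)) (g z) := mdist_ge0 _ _.
have q1 n : d (g (a (k n).+1)) (f z) <= d (g (a (k n).+1)) (g z) + l.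
  by rewrite /l (metric_sym (f z)); exact: metric_triangle.
apply: (@contraction_limit (a \o k) (cst z) l) => //=.
- by apply: nearW => n; exact: (hk n).2.
- apply: (squeeze_cvgr _ le_cvgN le_cvg); apply: nearW => n; rewrite -ga /e.
  have := metric_triangle (f z) (g (a (k n).+1)) (g z).
  rewrite -/l (metric_sym (f z) (g (a _))).
  by have := q1 n; have := p0 n; lra.
- apply: (squeeze_cvgr _ (cvg_cst l) le_cvg).
  apply: nearW => n; apply/andP; split.
    by rewrite /l metric_sym; exact: Mfg_ge_dist_right.
  have := p0 n; have := p1 n; have := q1 n.
  have := metric_triangle (g (a (k n))) (g z) (g (a (k n).+1)).
  have := metric_triangle (g (a (k n))) (g z) (f z).
  rewrite (metric_sym (g z) (g (a _))) (metric_sym (g z) (f z)) -/l => *.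
  apply: Mfg_le; rewrite -?ga ?(metric_sym (g z)) -/l /e; lra.
Qed.

End jungck.
End contraction_principles.

End contraction.

(** * Existence and uniqueness of the point of coincidence *)

Lemma jungck_cvg (R : realType) (G : R -> R -> R) (CG : R)
    (X : completeMetricType R) (f g : X -> X) (a : nat -> X) :
  property_C G CG -> suzuki_contraction G CG f g ->
  (forall n, g (a n.+1) = f (a n)) -> (forall n, f (a n) <> g (a n)) ->
  exists z : X, (fun n => g (a n)) @ \oo --> z.
Proof.
move=> hCG hf ga fga; apply/cvg_ex.
apply: (@cauchy_cvg X); apply: (@cauchy_exP R X) => e e0.
have [N aN] := jungck_tail hCG hf ga fga _ e0.
exists (g (a N)); exists N => // n Nn.
by rewrite /= ballEmdist; exact: aN.
Qed.

Theorem theorem3p2 (R : realType) (G : R -> R -> R) (CG : R)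
    (hG : C_class G) (hCG : property_C G CG)
    (X : completeMetricType R) (f g : X -> X)
    (hf : suzuki_contraction G CG f g)
    (hfg : range f `<=` range g)
    (hg : continuous g)
    (hcomm : forall x : X, f (g x) = g (f x)) :
  exists! u : X, point_of_coincidence f g u.
Proof.
have [v fv] : exists v, f v = g v.
  apply: contrapT => nocoinc.
  have nc v : f v <> g v by move=> fgv; apply: nocoinc; exists v.
  have [next gnext] : {next : X -> X & forall x, g (next x) = f x}.
    by apply: (choice (P := fun x y => g y = f x)) => x;
      have [y _ gy] := hfg (f x) (ex_intro2 _ _ x I erefl); exists y.
  pose a n := iter n next point.
  have ga n : g (a n.+1) = f (a n) by exact: gnext.
  have [z az] := jungck_cvg _ _ _ _ _ _ _ hCG hf ga (fun n => nc (a n)).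
  apply: (nc z).
  apply: (@jungck_limit_coincidence R X G CG f g hCG hf (g \o a)).
  (* g o a is used instead of a because its g-images converge to g z. *)
  - by move=> n /=; rewrite hcomm ga.
  - by move=> n; exact: nc.
  - exact: continuous_cvg (hg z) az.
exists (f v); split; first by exists v.
move=> _ [w [-> fw]]; apply: contrapT => vw.
have pair : suzuki_pair f g v w.
  by rewrite /suzuki_pair -fv -fw mdistxx mulr0 mdist_gt0; exact/eqP.
have := contraction_lt hCG hf _ _ pair vw; apply/negP; rewrite -leNgt.
apply: Mfg_le; rewrite -?fv -?fw ?mdistxx ?mdist_ge0//.
by rewrite (metric_sym (f w)).
Qed.
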